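(* Let $k\geq 1$ and let $D$ be a $k$-minimal digraph. Let $\varphi$ be an acyclic and complete coloring of $D$ with exactly $k$ colors, with chromatic classes $V_1,\dots,V_k$, where $|V_i|=q_i$ and $V_i=\{u_{i,1},\dots,u_{i,q_i}\}$. For each $i\in[k]$ let $m_i\geq 2$ and let $X_i=\{H_{u_{i,1}},\dots,H_{u_{i,q_i}}\}$ be a relabel factorization of $K_{m_i}$ into $q_i$ factors, where all the digraphs $H_{u_{i,j}}$ ($i\in[k]$, $j\in[q_i]$) are pairwise vertex-disjoint. Let $X=\bigcup_{i=1}^k X_i=\{H_u : u\in V(D)\}$ and $t=\sum_{i=1}^k m_i$. Then the Zykov sum $D[X]$ is $t$-minimal.
   Context: All digraphs are finite and simple (no loops, no parallel arcs; two opposite arcs forming a 2-cycle are allowed). $[n]=\{1,\dots,n\}$. $K_m$ denotes the complete symmetric digraph on $m$ vertices (every ordered pair of distinct vertices is an arc). A vertex coloring with $k$ colors is a surjection $V(D)\to[k]$; its chromatic classes are the preimages of the colors. A coloring is acyclic if each chromatic class induces a subdigraph with no directed cycle. A coloring is complete if for every ordered pair $(i,j)$ of distinct colors there is at least one arc $uv$ with $u$ colored $i$ and $v$ colored $j$. The diachromatic number $\mathrm{dac}(D)$ is the largest $k$ for which $D$ has an acyclic and complete coloring with $k$ colors. $D$ is $k$-minimal if $\mathrm{dac}(D)=k$ and $\mathrm{dac}(D-f)<k$ for every arc $f$ of $D$ (it is known that a digraph with $\mathrm{dac}(D)=k$ is $k$-minimal iff it has exactly $k(k-1)$ arcs). A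 relabel factorization of $K_m$ into $q$ factors is a family of $q$ pairwise vertex-disjoint digraphs $H_1,\dots,H_q$, where $H_j$ has vertex set $\{v^1_j,\dots,v^m_j\}$, such that for every ordered pair $(a,b)$ of distinct elements of $[m]$ there is exactly one $j\in[q]$ with $v^a_jv^b_j\in A(H_j)$, and every arc of every $H_j$ is of this form (equivalently, identifying each $v^l_j$ with vertex $l$ of $K_m$, the $H_j$ are spanning subdigraphs of $K_m$ whose arc sets partition $A(K_m)$). Zykov sum: given a digraph $D$ and a family $X=\{H_u: u\in V(D)\}$ of nonempty pairwise vertex-disjoint digraphs, $D[X]$ has vertex set $\bigcup_u V(H_u)$ and arc set $\bigcup_u A(H_u)\cup\{ab: a\in V(H_u), b\in V(H_v), uv\in A(D)\}$. *)

(* Defs.v *)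
From HB Require Import structures.
From mathcomp Require Import all_boot.
From mathcomp Require Import boolp.

Set Implicit Arguments.
Unset Strict Implicit.
Unset Printing Implicit Defensive.

Record digraph := Digraph {
  vertex :> finType;
  arc : rel vertex;
  arc_irr : irreflexive arc }.

Arguments arc {d} _ _.

Section Constructions.
Variable D : digraph.

Definition del_arc_rel (x y : D) : rel D :=
  [rel a b | arc a b && ((a, b) != (x, y))].

Fact del_arc_irr (x y : D) : irreflexive (del_arc_rel x y).
Proof. by move=> a; rewrite /del_arc_rel /= arc_irr. Qed.

Definition del_arc (x y : D) : digraph := Digraph (del_arc_irr x y).

Definition induced_rel (S : {set D}) : rel {x : D | x \in S} :=
  [rel a b | arc (val a) (val b)].

Fact induced_irr (S : {set D}) : irreflexive (@induced_rel S).
Proof. by move=> a; rewrite /induced_rel /= arc_irr. Qed.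

Definition induced (S : {set D}) : digraph := Digraph (@induced_irr S).

(* The disjoint union of the vertex sets is the sigma type {u : D & H u}, so
   the summands are vertex-disjoint by construction. *)
Definition zykov_rel (H : D -> digraph) : rel {u : D & H u} :=
  [rel a b | arc (tag a) (tag b)
          || (tag a == tag b) && arc (tagged a) (tagged_as a b)].

Fact zykov_irr (H : D -> digraph) : irreflexive (@zykov_rel H).
Proof. by case=> u x; rewrite /zykov_rel /= tagged_asE !arc_irr andbF. Qed.

Definition zykov (H : D -> digraph) : digraph := Digraph (@zykov_irr H).

End Constructions.

Definition acyclic (D : digraph) : Prop :=
  forall c : seq D, c != [::] -> ~ ucycle arc c.

Section Colorings.
Variables (D : digraph) (k : nat) (phi : D -> 'I_k).

Definition is_coloring : Prop := forall i, exists u, phi u = i.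

Definition chromatic_class (i : 'I_k) : {set D} := [set u | phi u == i].

Definition acyclic_coloring : Prop :=
  forall i, acyclic (induced (chromatic_class i)).

Definition complete_coloring : Prop :=
  forall i j : 'I_k, i != j ->
  exists u v : D, [/\ arc u v, phi u = i & phi v = j].

Definition acyclic_complete_coloring : Prop :=
  [/\ is_coloring, acyclic_coloring & complete_coloring].

End Colorings.

(* A surjection onto k colors forces k <= #|D|, so the bound on k is harmless:
   see leq_dac and dac_attained. *)
Definition dac (D : digraph) : nat :=
  \max_(k < #|D|.+1
        | `[< exists phi : D -> 'I_k, acyclic_complete_coloring phi >]) k.

Lemma leq_dac (D : digraph) (k : nat) (phi : D -> 'I_k) :
  acyclic_complete_coloring phi -> k <= dac D.
Proof.
move=> Hphi; have [surj _ _] := Hphi.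
have lekD : k < #|D|.+1.
  rewrite ltnS -[k in k <= _]card_ord.
  have -> : #|'I_k| = #|codom phi|.
    apply: eq_card => i; rewrite inE; apply/esym.
    by have [u <-] := surj i; rewrite codom_f.
  exact: leq_image_card.
rewrite /dac (bigD1 (Ordinal lekD)) /=; first exact: leq_maxl.
by apply/asboolP; exists phi.
Qed.

Lemma dac_attained (D : digraph) : 0 < dac D ->
  exists phi : D -> 'I_(dac D), acyclic_complete_coloring phi.
Proof.
rewrite /dac; elim/big_rec: _ => //= i n Pi IHn.
by case: (leqP i n) => // _ _; apply/asboolP.
Qed.

Definition minimal_digraph (k : nat) (D : digraph) : Prop :=
  dac D = k /\ forall x y : D, arc x y -> dac (del_arc x y) < k.

(* v j a is the vertex v^a_j; the factors are indexed by a finite type J, so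
   their number is #|J|. *)
Definition relabel_factorization (m : nat) (J : finType) (H : J -> digraph)
    : Prop :=
  exists v : forall j : J, 'I_m -> H j,
  [/\ forall j, bijective (v j),
      forall a b : 'I_m, a != b -> exists! j : J, arc (v j a) (v j b)
    & forall j (x y : H j), arc x y ->
      exists a b : 'I_m, [/\ a != b, x = v j a & y = v j b]].

(* Main.v *)
(** Deleting an arc of a [k]-minimal digraph must destroy the completeness of
    any acyclic complete [k]-coloring, so sending an arc to the ordered pair of
    colors of its ends is a bijection onto the pairs of distinct colors: the
    coloring is exact.  Conversely a digraph with an exact [k]-coloring has
    [k (k - 1)] arcs, while [dac = s] requires at least [s (s - 1)] arcs, so it
    is [k]-minimal.  In the Zykov sum, give the vertex [v^a_u] of [H_u] the color
    [(phi u, a)].  Two colors with different first components are joined by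
    exactly one arc between summands, because [phi] is exact; two colors [(i, a)]
    and [(i, b)] by exactly one arc inside a summand, because the summands over
    the color [i] factorize a complete digraph. *)

From HB Require Import structures.
From mathcomp Require Import all_boot all_order.
From mathcomp Require Import boolp.
Require Import Defs.

Set Implicit Arguments.
Unset Strict Implicit.
Unset Printing Implicit Defensive.

Section BijectiveOn.
Variables (aT rT : finType) (f : aT -> rT).
Implicit Types (A : {set aT}) (B : {set rT}).

Definition bijective_on A B : Prop := {in A &, injective f} /\ f @: A = B.

Lemma bijective_on_intro A B :
  (forall a, a \in A -> f a \in B) -> {in A &, injective f} ->
  (forall b, b \in B -> exists2 a, a \in A & f a = b) -> bijective_on A B.
Proof.
move=> AB inj onto; split=> //; apply/setP=> b.
apply/imsetP/idP => [[a /AB Bfa ->] //|/onto[a Aa <-]].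
by exists a.
Qed.

Lemma bijective_on_mem A B a : bijective_on A B -> a \in A -> f a \in B.
Proof. by move=> [_ <-]; apply: imset_f. Qed.

Lemma bijective_on_onto A B b :
  bijective_on A B -> b \in B -> exists2 a, a \in A & f a = b.
Proof. by move=> [_ <-] /imsetP[a Aa ->]; exists a. Qed.

Lemma bijective_on_card A B : bijective_on A B -> #|A| = #|B|.
Proof. by move=> [/card_in_imset <- ->]. Qed.

Lemma bijective_onU A A' B B' :
  bijective_on A B -> bijective_on A' B' -> [disjoint B & B'] ->
  bijective_on (A :|: A') (B :|: B').
Proof.
move=> bij bij' disj; split; last by rewrite imsetU bij.2 bij'.2.
have image_disjoint a a' : a \in A -> a' \in A' -> f a <> f a'.
  move=> /(bijective_on_mem bij)/(disjointFr disj) fa_notB'.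
  by move=> /(bijective_on_mem bij') fa'_B' e; rewrite e fa'_B' in fa_notB'.
move=> a a' /setUP[Aa|Aa] /setUP[Aa'|Aa'] e.
- exact: bij.1.
- by case: (image_disjoint a a').
- by case: (image_disjoint a' a).
- exact: bij'.1.
Qed.

Lemma minimal_cover_bijective_on A B :
  B \subset f @: A ->
  (forall a, a \in A -> ~~ (B \subset f @: (A :\ a))) -> bijective_on A B.
Proof.
move=> cover min; split.
  move=> a a' Aa Aa' faa'; apply/eqP; apply: contraT => neq.
  case/negP: (min a Aa); apply: subset_trans cover _.
  apply/subsetP => _ /imsetP[b Ab ->].
  have [->|ba] := eqVneq b a; last by rewrite imset_f // !inE ba.
  by rewrite faa' imset_f // !inE eq_sym neq.
apply/eqP; rewrite eqEsubset cover andbT.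
apply/subsetP => _ /imsetP[a Aa ->]; apply: contraT => Bfa.
case/negP: (min a Aa); apply/subsetP => b Bb.
have /imsetP[a' Aa' bE] := subsetP cover b Bb.
rewrite bE imset_f // !inE Aa' andbT.
by apply: contraNneq Bfa => <-; rewrite -bE.
Qed.

End BijectiveOn.

Definition offdiag (T : finType) : {set T * T} := [set p | p.1 != p.2].

Lemma card_offdiag (T : finType) : #|offdiag T| = #|T| * #|T|.-1.
Proof.
have -> : offdiag T = ~: [set (x, x) | x : T].
  apply/setP=> -[x y]; rewrite !inE /=; congr negb.
  by apply/eqP/imsetP => [->|[z _ [-> ->]]]; first exists y.
rewrite cardsCs setCK card_imset; last by move=> x y [].
by rewrite card_prod -[X in _ - X]muln1 -mulnBr subn1.
Qed.

Lemma leq_mul_pred (s t : nat) : s <= t -> s * s.-1 <= t * t.-1.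
Proof. by move=> le_st; rewrite leq_mul // -!subn1 leq_sub2r. Qed.

Lemma ltn_mul_pred (s t : nat) : 0 < s -> s < t -> s * s.-1 < t * t.-1.
Proof. by case: s t => // s [//|t] _ lt_st; apply: ltn_mul. Qed.

Definition arcs (D : digraph) : {set D * D} := [set p | arc p.1 p.2].

Lemma arcs_del_arc (D : digraph) (x y : D) :
  arcs (del_arc x y) = arcs D :\ (x, y).
Proof. by apply/setP => -[a b]; rewrite !inE /= andbC. Qed.

Definition color_pair (V T : Type) (c : V -> T) (p : V * V) : T * T :=
  (c p.1, c p.2).

Lemma complete_coloringP (D : digraph) (k : nat) (c : D -> 'I_k) :
  complete_coloring c <-> offdiag 'I_k \subset color_pair c @: arcs D.
Proof.
split=> [compl|/subsetP cover i j ij].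
  apply/subsetP => -[i j]; rewrite inE /= => /compl[x [y [xy <- <-]]].
  by apply/imsetP; exists (x, y); rewrite ?inE.
have [|[x y] + [-> ->]] := imsetP (cover (i, j) _); first by rewrite inE.
by rewrite inE => xy; exists x, y.
Qed.

Lemma leq_dac_arcs (D : digraph) : dac D * (dac D).-1 <= #|arcs D|.
Proof.
case: (posnP (dac D)) => [-> //|/dac_attained[c [_ _ /complete_coloringP]]].
move=> /subset_leq_card; rewrite card_offdiag card_ord => /leq_trans; apply.
exact: leq_imset_card.
Qed.

Lemma acyclic_arcless (D : digraph) :
  (forall x y : D, ~~ arc x y) -> acyclic D.
Proof.
move=> no_arc [|x c] //= _ /andP[].
by case: c => [|y c] /=; rewrite (negPf (no_arc _ _)).
Qed.

Lemma acyclic_subrel (V : finType) (e e' : rel V)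
    (irr : irreflexive e) (irr' : irreflexive e') :
  subrel e' e -> acyclic (Digraph irr) -> acyclic (Digraph irr').
Proof.
move=> sub acy c c0 /andP[cyc un]; apply: (acy c c0).
by rewrite /ucycle un (sub_cycle sub cyc).
Qed.

Definition exact_coloring (D : digraph) (T : finType) (c : D -> T) : Prop :=
  bijective_on (color_pair c) (arcs D) (offdiag T).

Lemma exact_coloring_neq (D : digraph) (T : finType) (c : D -> T) (x y : D) :
  exact_coloring c -> arc x y -> c x != c y.
Proof.
move=> exact_c xy.
by have := bijective_on_mem (a := (x, y)) exact_c; rewrite !inE; apply.
Qed.

Lemma minimal_coloring_exact (D : digraph) (k : nat) (phi : D -> 'I_k) :
  minimal_digraph k D -> acyclic_complete_coloring phi -> exact_coloring phi.
Proof.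
move=> [_ minD] [surj acy /complete_coloringP cover].
apply: minimal_cover_bijective_on => // -[x y]; rewrite inE /= => xy.
apply/negP; rewrite -arcs_del_arc => cover_del.
have := minD x y xy; rewrite ltnNge => /negP; apply.
apply: (@leq_dac (del_arc x y) k phi).
split=> //; last exact/complete_coloringP.
by move=> i; apply: acyclic_subrel (acy i) => a b /= /andP[].
Qed.

Lemma exact_coloring_acyclic_complete (D : digraph) (k : nat) (c : D -> 'I_k) :
  is_coloring c -> exact_coloring c -> acyclic_complete_coloring c.
Proof.
move=> surj exact_c; split=> // [i|]; last first.
  by apply/complete_coloringP; rewrite exact_c.2.
apply: acyclic_arcless => x y; apply/negP => /(exact_coloring_neq exact_c).
by move: (valP x) (valP y); rewrite !inE => /eqP-> /eqP->; rewrite eqxx.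
Qed.

Lemma exact_coloring_minimal (D : digraph) (k : nat) (c : D -> 'I_k) :
  0 < k -> is_coloring c -> exact_coloring c -> minimal_digraph k D.
Proof.
move=> k_gt0 surj exact_c.
have arcsE : #|arcs D| = k * k.-1.
  by rewrite (bijective_on_card exact_c) card_offdiag card_ord.
have le_k_dac := leq_dac (exact_coloring_acyclic_complete surj exact_c).
split=> [|x y xy].
  apply/eqP; rewrite eqn_leq le_k_dac andbT leqNgt.
  apply: contraL (leq_dac_arcs D) => lt_k_dac.
  by rewrite -ltnNge arcsE ltn_mul_pred.
rewrite ltnNge; apply: contraL (leq_dac_arcs (del_arc x y)) => /leq_mul_pred.
rewrite -ltnNge -arcsE (cardsD1 (x, y) (arcs D)) -arcs_del_arc.
by rewrite inE xy.
Qed.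

Section ZykovColoring.
Variables (D : digraph) (H : D -> digraph).

Definition zykov_in (u : D) (h : H u) : zykov H := existT _ u h.

Lemma zykov_in_inj (u : D) : injective (@zykov_in u).
Proof. by move=> h h' /eqP; rewrite eq_Tagged => /eqP. Qed.

Definition outer_arcs : {set zykov H * zykov H} :=
  [set z | arc (tag z.1) (tag z.2)].

Definition inner_arcs : {set zykov H * zykov H} :=
  [set z | (tag z.1 == tag z.2) && arc (tagged z.1) (tagged_as z.1 z.2)].

Lemma arcs_zykov : arcs (zykov H) = inner_arcs :|: outer_arcs.
Proof. by apply/setP => z; rewrite !inE orbC. Qed.

Lemma inner_arcsP (z : zykov H * zykov H) :
  reflect (exists u (h h' : H u), arc h h' /\ z = (zykov_in h, zykov_in h'))
          (z \in inner_arcs).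
Proof.
apply: (iffP idP) => [|[u [h [h' [hh' ->]]]]]; last first.
  by rewrite inE /= eqxx tagged_asE.
case: z => -[u h] [u' h']; rewrite inE /= => /andP[/eqP eu].
by case: u' / eu h' => h'; rewrite tagged_asE; exists u, h, h'.
Qed.

Variables (I T : finType) (phi : D -> I) (p : T -> I) (c : zykov H -> T).

Definition fiber_coloring : Prop :=
  bijective_on (fun x : zykov H => (tag x, c x))
    setT [set q | phi q.1 == p q.2].

Definition summand_realizes (u : D) (t t' : T) : Prop :=
  exists h h' : H u, [/\ arc h h', c (zykov_in h) = t & c (zykov_in h') = t'].

Definition factorizing_coloring : Prop :=
  forall t t', t != t' -> p t = p t' -> exists! u, summand_realizes u t t'.

Hypothesis c_fiber : fiber_coloring.

Lemma fiber_coloring_proj (x : zykov H) : p (c x) = phi (tag x).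
Proof. by have := bijective_on_mem c_fiber (in_setT x); rewrite inE => /eqP. Qed.

Lemma fiber_coloring_inj (x y : zykov H) : tag x = tag y -> c x = c y -> x = y.
Proof. by move=> et ec; apply: c_fiber.1; rewrite ?inE //= et ec. Qed.

Lemma fiber_coloring_onto (u : D) (t : T) :
  phi u = p t -> exists2 x : zykov H, tag x = u & c x = t.
Proof.
move=> e; have [|x _ [<- <-]] := bijective_on_onto (b := (u, t)) c_fiber.
  by rewrite inE e.
by exists x.
Qed.

Lemma fiber_coloring_surj :
  (forall i, exists u, phi u = i) -> forall t, exists x, c x = t.
Proof.
move=> surj t; have [u /fiber_coloring_onto[x _ <-]] := surj (p t).
by exists x.
Qed.

Lemma outer_arcs_bijective :
  exact_coloring phi ->
  bijective_on (color_pair c) outer_arcs [set q | p q.1 != p q.2].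
Proof.
move=> phi_exact.
apply: bijective_on_intro => [[x y]|[x y] [x' y']|[t t']]; rewrite !inE /=.
- by rewrite !fiber_coloring_proj; apply: exact_coloring_neq.
- move=> xy xy' [ex ey].
  have [] : (tag x, tag y) = (tag x', tag y').
    apply: phi_exact.1; rewrite ?inE // /color_pair /=.
    by rewrite -!fiber_coloring_proj ex ey.
  by move=> /fiber_coloring_inj-> // /fiber_coloring_inj->.
- move=> tt'; have [|[u u']] := bijective_on_onto (b := (p t, p t')) phi_exact.
    by rewrite inE.
  rewrite inE /= => uu' [/fiber_coloring_onto[x xu <-]].
  move=> /fiber_coloring_onto[y yu <-].
  by exists (x, y); rewrite // inE /= xu yu.
Qed.

Lemma inner_arcs_bijective :
  factorizing_coloring ->
  bijective_on (color_pair c) inner_arcs [set q in offdiag T | p q.1 == p q.2].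
Proof.
move=> factor.
have inner_neq u (h h' : H u) : arc h h' -> c (zykov_in h) != c (zykov_in h').
  apply: contraTneq => e; suff -> : h = h' by rewrite arc_irr.
  exact/zykov_in_inj/fiber_coloring_inj.
have proj_in u (h : H u) : p (c (zykov_in h)) = phi u.
  exact: fiber_coloring_proj.
apply: bijective_on_intro => [z|z z'|[t t']].
- move=> /inner_arcsP[u [h [h' [hh' ->]]]].
  by rewrite !inE /= inner_neq //= !proj_in eqxx.
- move=> /inner_arcsP[u [g [g' [gg' ->]]]] /inner_arcsP[w [h [h' [hh' ->]]]].
  move=> [eg eg']; have [|u0 [_ unique_u0]] := factor _ _ (inner_neq _ _ _ gg').
    by rewrite !proj_in.
  have same_summand : u = w.
    transitivity u0; [symmetry|]; apply: unique_u0.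
      by exists g, g'.
    by exists h, h'.
  by congr pair; apply: fiber_coloring_inj.
- rewrite !inE /= => /andP[tt' /eqP ptt'].
  have [u [[h [h' [hh' <- <-]]] _]] := factor t t' tt' ptt'.
  by exists (zykov_in h, zykov_in h') => //; apply/inner_arcsP; exists u, h, h'.
Qed.

Lemma zykov_coloring_exact :
  exact_coloring phi -> factorizing_coloring -> exact_coloring c.
Proof.
move=> /outer_arcs_bijective outer /inner_arcs_bijective inner.
rewrite /exact_coloring arcs_zykov.
have -> : offdiag T = [set q in offdiag T | p q.1 == p q.2]
                      :|: [set q | p q.1 != p q.2].
  apply/setP => -[t t']; rewrite !inE /=.
  by have [->|] := eqVneq t t'; rewrite ?eqxx //= orbN.
apply: bijective_onU inner outer _.
by rewrite disjoint_subset; apply/subsetP => q; rewrite !inE negbK => /andP[].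
Qed.

End ZykovColoring.

Lemma eq_tagnat_Rank (n : nat) (m : 'I_n -> nat) (i : 'I_n) (a b : 'I_(m i)) :
  (tagnat.Rank i a == tagnat.Rank i b) = (a == b).
Proof. by rewrite -val_eqE tagnat.eq_Rank eqxx. Qed.

Section RelabelColoring.
Variables (D : digraph) (k : nat) (phi : D -> 'I_k) (m : 'I_k -> nat).
Variable H : D -> digraph.
Local Notation class i := {u : D | u \in chromatic_class phi i}.
Variable v : forall (i : 'I_k) (j : class i), 'I_(m i) -> H (sval j).
Hypothesis v_bij : forall i (j : class i), bijective (v j).

Fact mem_own_class (u : D) : u \in chromatic_class phi (phi u).
Proof. by rewrite inE. Qed.

Definition own_class (u : D) : class (phi u) := exist _ u (mem_own_class u).

Lemma own_class_ind (P : forall i, class i -> Prop) :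
  (forall u, P (phi u) (own_class u)) -> forall i (j : class i), P i j.
Proof.
move=> Pown i [u ui]; have e : phi u = i by move: (ui); rewrite inE => /eqP.
case: i / e ui => ui; suff -> : exist _ u ui = own_class u by [].
exact: val_inj.
Qed.

Fact mem_codom_relabel (u : D) (h : H u) : h \in codom (v (own_class u)).
Proof. by have [g _ gK] := v_bij (own_class u); rewrite -(gK h) codom_f. Qed.

Definition relabel_color (x : zykov H) : 'I_(\sum_(i < k) m i) :=
  tagnat.Rank (phi (tag x)) (iinv (mem_codom_relabel (tagged x))).

Lemma relabel_colorE i (j : class i) a :
  relabel_color (zykov_in (v j a)) = tagnat.Rank i a.
Proof.
elim/own_class_ind: i / j a => u a; congr tagnat.Rank.
by apply: (bij_inj (v_bij (own_class u))); rewrite f_iinv.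
Qed.

Lemma relabel_color_fiber : fiber_coloring phi tagnat.sig1 relabel_color.
Proof.
apply: bijective_on_intro => [x _|[u h] [u' h'] _ _|[u t]].
- by rewrite inE /= tagnat.Rank1K.
- move=> /pair_equal_spec[/= eu]; case: u' / eu h' => h' /eqP.
  rewrite /relabel_color /= eq_tagnat_Rank => /eqP e.
  by rewrite -(f_iinv (mem_codom_relabel h)) e f_iinv.
- rewrite inE /= => ut.
  have ui : u \in chromatic_class phi (tagnat.sig1 t) by rewrite inE.
  exists (zykov_in (v (exist _ u ui) (tagnat.sig2 t))) => //.
  by congr pair; rewrite relabel_colorE tagnat.sig2K.
Qed.

Lemma relabel_color_factorizing :
  (forall i (a b : 'I_(m i)), a != b ->
     exists! j : class i, arc (v j a) (v j b)) ->
  factorizing_coloring tagnat.sig1 relabel_color.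
Proof.
move=> factor t t'; rewrite -[t]tagnat.sig2K -[t']tagnat.sig2K !tagnat.Rank1K.
move: (tagnat.sig2 t) (tagnat.sig2 t') => a + /[swap] ei.
case: _ / ei => b; rewrite eq_tagnat_Rank => /factor[j [ab unique_j]].
exists (sval j); split=> [|u [h [h' [hh' ha hb]]]].
  by exists (v j a), (v j b); rewrite !relabel_colorE.
have ui : u \in chromatic_class phi (tagnat.sig1 t).
  rewrite inE -(fiber_coloring_proj relabel_color_fiber (zykov_in h)) ha.
  by rewrite tagnat.Rank1K.
pose ju : class (tagnat.sig1 t) := exist _ u ui.
have vertexE g l : relabel_color (zykov_in g) = tagnat.Rank _ l -> g = v ju l.
  move=> gl; apply/zykov_in_inj/(fiber_coloring_inj relabel_color_fiber) => //.
  by rewrite gl relabel_colorE.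
by rewrite (unique_j ju) // -(vertexE _ _ ha) -(vertexE _ _ hb).
Qed.

End RelabelColoring.

Theorem theorem2 (k : nat) (k_ge1 : 1 <= k) (D : digraph)
    (D_min : minimal_digraph k D)
    (phi : D -> 'I_k) (phi_ac : acyclic_complete_coloring phi)
    (m : 'I_k -> nat) (m_ge2 : forall i : 'I_k, 2 <= m i)
    (H : D -> digraph)
    (H_fact : forall i : 'I_k,
       @relabel_factorization (m i) {u : D | u \in chromatic_class phi i}
         (fun u => H (sval u))) :
  minimal_digraph (\sum_(i < k) m i) (zykov H).
Proof.
have [surj _ _] := phi_ac.
have phi_exact := minimal_coloring_exact D_min phi_ac.
pose v i := sval (cid (H_fact i)).
have v_bij i j : bijective (v i j) by case: (svalP (cid (H_fact i))).
have factor i (a b : 'I_(m i)) : a != b -> exists! j, arc (v i j a) (v i j b).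
  by case: (svalP (cid (H_fact i))) => _ + _; apply.
have c_fiber := relabel_color_fiber v_bij.
apply: (exact_coloring_minimal (c := relabel_color v_bij)).
- by rewrite (bigD1 (Ordinal k_ge1)) //= addn_gt0 ltnW.
- exact: fiber_coloring_surj c_fiber surj.
- apply: (zykov_coloring_exact c_fiber phi_exact).
  exact: relabel_color_factorizing factor.
Qed.
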